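(* Let $b\ge2$ and $N\ge1$ be integers with $\gcd(N,b)=1$. If $2\in\mathcal{M}_b(N)$ and $d$ is an even divisor of $|b|_N$, then $d\in\mathcal{M}_b(N)$ and $m_b(d,N)=\frac d2$.
   Context: $|b|_N$ denotes the multiplicative order of $b$ modulo $N$, and $\mathbb{U}_N=\{x: 1\le x<N,\ \gcd(x,N)=1\}$. Midy's set: for an integer $d\ge 2$ dividing $|b|_N$, put $L=|b|_N$ and $k=L/d$. For $x\in\mathbb{U}_N$, let $a_1\cdots a_L$ be the base-$b$ digits (padded with leading zeros to exactly $L$ digits) of the integer $x(b^L-1)/N$ (the period of the base-$b$ expansion of $x/N$). For $j=1,\dots,d$ let $A_j=[a_{(j-1)k+1}\cdots a_{jk}]_b$ be the integer with the $j$-th block of $k$ digits, and $S_d(x)=\sum_{j=1}^d A_j$. $N$ has the Midy property for $b$ and $d$ if $b^k-1\mid S_d(x)$ for all $x\in\mathbb{U}_N$; $\mathcal{M}_b(N)$ is the set of such $d$. For $d\in\mathcal{M}_b(N)$ with $k=|b|_N/d$, the number $\sum_{i=1}^d (b^{ik}\bmod N)$ (where $y\bmod N$ is the least nonnegative residue) is a multiple of $N$, and $m_b(d,N)$ is defined by $\sum_{i=1}^d (b^{ik}\bmod N)=m_b(d,N)\,N$. *)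

(* Defs.v *)
From mathcomp Require Import all_boot all_solvable.

Set Implicit Arguments.
Unset Strict Implicit.
Unset Printing Implicit Defensive.

Lemma mult_order_ex (b N : nat) :
  exists n, (0 < n) && (coprime N b ==> (b ^ n == 1 %[mod N])).
Proof.
case: (posnP N) => [-> | N_gt0].
  exists 1; rewrite /coprime gcd0n expn1 /=.
  by apply/implyP=> /eqP ->.
exists (totient N); rewrite totient_gt0 N_gt0 /=.
by apply/implyP; rewrite coprime_sym => cobN; rewrite Euler_exp_totient.
Qed.

(* The least n >= 1 with b ^ n = 1 modulo N. The value for b and N not
   coprime is junk. This is used instead of #[_] in {unit 'Z_N} because 'Z_1
   is not the trivial ring. *)
Definition mult_order (b N : nat) : nat := ex_minn (mult_order_ex b N).

Definition block_length (b d N : nat) : nat := mult_order b N %/ d.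

(* The division is exact, as N divides b ^ mult_order b N - 1 when b and N are
   coprime. *)
Definition period (b N x : nat) : nat := x * (b ^ mult_order b N - 1) %/ N.

(* Digits are numbered from 1, the most significant one first, in an expansion
   padded to mult_order b N digits. *)
Definition period_digit (b N x i : nat) : nat :=
  period b N x %/ b ^ (mult_order b N - i) %% b.

Definition midy_block (b d N x j : nat) : nat :=
  let k := block_length b d N in
  \sum_((j - 1) * k + 1 <= i < j * k + 1)
    period_digit b N x i * b ^ (j * k - i).

Definition midy_sum (b d N x : nat) : nat :=
  \sum_(1 <= j < d.+1) midy_block b d N x j.

Definition midy_property (b d N : nat) : Prop :=
  forall x : nat, 1 <= x < N -> coprime x N ->
    b ^ block_length b d N - 1 %| midy_sum b d N x.

Definition in_midy_set (b N d : nat) : Prop :=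
  [/\ 2 <= d, d %| mult_order b N & midy_property b d N].

(* m_b(d, N) = m, as a relation: m is determined by the equation since N > 0,
   and this form also asserts that the sum is a multiple of N. *)
Definition midy_multiplier (b d N m : nat) : Prop :=
  \sum_(1 <= i < d.+1) (b ^ (i * block_length b d N) %% N) = m * N.

(* Main.v *)
Require Import Defs.
From mathcomp Require Import all_boot zify.

Set Implicit Arguments.
Unset Strict Implicit.
Unset Printing Implicit Defensive.

(** Since b^k = 1 modulo b^k - 1, S_d(x) is congruent to the whole period
    x (b^L - 1) / N, so d is in the Midy set iff N divides
    (b^L - 1) / (b^k - 1) = 1 + b^k + ... + b^((d-1)k).  For d = 2 this reads
    b^(L/2) = -1 modulo N.  For d = 2e the geometric sum contains the factor
    1 + b^(ek) = 1 + b^(L/2), and the residues of b^(ik) and b^((i+e)k) add up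
    to N, which gives e pairs of sum N. *)

Lemma mult_order_gt0 (b N : nat) : 0 < mult_order b N.
Proof. by rewrite /mult_order; case: ex_minnP => n /andP[]. Qed.

Lemma dvdn_exp_mult_order (b N : nat) :
  0 < b -> coprime N b -> N %| b ^ mult_order b N - 1.
Proof.
move=> b0 co; rewrite -eqn_mod_dvd ?expn_gt0 ?b0 //.
by rewrite /mult_order; case: ex_minnP => n /andP[_ /implyP /(_ co)].
Qed.

(** Induction on [n]: dividing [P %% b ^ n.+1] by [b ^ n] gives the next digit as quotient and
    [P %% b ^ n] as remainder. *)
Lemma sum_digits (b P n : nat) :
  \sum_(i < n) (P %/ b ^ i %% b) * b ^ i = P %% b ^ n.
Proof.
elim: n => [|n IH]; first by rewrite big_ord0 modn1.
rewrite big_ord_recr /= IH expnS modn_divl.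
have -> : P %% b ^ n = (P %% (b * b ^ n)) %% b ^ n.
  by rewrite modn_dvdm ?dvdn_mull.
by rewrite addnC -divn_eq.
Qed.

Lemma sum_nat_blocks (F : nat -> nat) (k d : nat) :
  \sum_(1 <= j < d.+1) \sum_((j - 1) * k + 1 <= i < j * k + 1) F i
  = \sum_(1 <= i < d * k + 1) F i.
Proof.
elim: d => [|d IH]; first by rewrite !big_geq.
rewrite big_nat_recr //= IH subn1 /= -big_cat_nat //; lia.
Qed.

Lemma modn_exp_pred (c i : nat) : 0 < c -> c ^ i = 1 %[mod c - 1].
Proof.
move=> c0; apply/eqP; rewrite eqn_mod_dvd ?expn_gt0 ?c0 //.
by rewrite !subn1 predn_exp dvdn_mulr.
Qed.

Lemma modn_sum_nat (m n M : nat) (F G : nat -> nat) :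
  (forall i, m <= i < n -> F i = G i %[mod M]) ->
  \sum_(m <= i < n) F i = \sum_(m <= i < n) G i %[mod M].
Proof.
move=> FG; rewrite -[LHS]modn_summ -[RHS]modn_summ.
by congr (_ %% _); apply: eq_big_nat.
Qed.

Lemma midy_sum_mod (b d N x : nat) :
  0 < b -> x < N -> d %| mult_order b N ->
  midy_sum b d N x = period b N x %[mod b ^ block_length b d N - 1].
Proof.
move=> b0 xN dL; rewrite /midy_sum /midy_block.
set k := block_length b d N; set L := mult_order b N.
have Ldk : L = d * k by rewrite mulnC /k /block_length divnK.
pose F i := period_digit b N x i * b ^ (L - i).
transitivity ((\sum_(1 <= j < d.+1)
    \sum_((j - 1) * k + 1 <= i < j * k + 1) F i) %% (b ^ k - 1)).
  apply: modn_sum_nat => j /andP[j1 jd]; apply: modn_sum_nat => i /andP[_ ij].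
  have jdk : j * k <= d * k by rewrite leq_mul2r -ltnS jd orbT.
  (* The weight of a digit in the whole period is its weight in block [j] times a power of [b ^ k],
     which is 1 modulo [b ^ k - 1]. *)
  have -> : F i = period_digit b N x i * b ^ (j * k - i) * (b ^ k) ^ (d - j).
    rewrite /F -mulnA -expnM -expnD; congr (_ * b ^ _).
    by rewrite Ldk; nia.
  by rewrite -[in RHS]modnMmr modn_exp_pred ?expn_gt0 ?b0 // modnMmr muln1.
rewrite sum_nat_blocks -Ldk addn1 big_add1 /= big_mkord.
(* Digits are numbered from the most significant one, but [sum_digits] counts from the lowest. *)
rewrite (reindex_inj rev_ord_inj) /=.
rewrite (eq_bigr (fun i : 'I_L => (period b N x %/ b ^ i %% b) * b ^ i)); last first.
  move=> i _; rewrite /F /period_digit -/L.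
  by have -> : L - (L - i.+1).+1 = i by have := ltn_ord i; lia.
(* As [x < N], the period is below [b ^ L], so its [L] digits recover it in full. *)
rewrite sum_digits [X in X %% _]modn_small //.
have bL : 0 < b ^ L by rewrite expn_gt0 b0.
rewrite /period -/L ltn_divLR; nia.
Qed.

(** The period of [x] is [x * q], so the case [x = 1] decides: the property amounts to
    [b ^ k - 1 %| q]. Multiplying by [N] and cancelling [b ^ k - 1] leaves the geometric sum. *)
Lemma midy_propertyP (b d N : nat) :
  2 <= b -> 1 < N -> coprime N b -> d %| mult_order b N ->
  midy_property b d N <-> N %| \sum_(i < d) (b ^ block_length b d N) ^ i.
Proof.
move=> b2 N1 co dL; have b0 : 0 < b by lia.
pose k := block_length b d N; pose q := (b ^ mult_order b N - 1) %/ N.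
have NL := dvdn_exp_mult_order b0 co.
have k0 : 0 < k by rewrite divn_gt0 ?(dvdn_leq (mult_order_gt0 _ _)) //
  (dvdn_gt0 (mult_order_gt0 b N)).
have bk : 0 < b ^ k - 1 by rewrite subn_gt0 -(expn0 b) ltn_exp2l.
have geom : (b ^ k - 1) * \sum_(i < d) (b ^ k) ^ i = q * N.
  by rewrite subn1 -predn_exp -expnM /k /block_length divnK // -subn1 /q divnK.
have perE x : period b N x = x * q by rewrite /period muln_divA.
have propE x : x < N ->
    (b ^ k - 1 %| midy_sum b d N x) = (b ^ k - 1 %| x * q).
  by move=> xN; rewrite /dvdn midy_sum_mod // perE.
have divE : (b ^ k - 1 %| q) = (N %| \sum_(i < d) (b ^ k) ^ i).
  rewrite -(@dvdn_pmul2r N) ?(ltnW N1) // -geom.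
  by rewrite dvdn_pmul2l.
rewrite -divE; split=> [mp | qd x /andP[_ xN] _].
  by have := mp 1; rewrite propE // mul1n; apply; rewrite ?N1 ?coprime1n.
by rewrite propE // dvdn_mull.
Qed.

(** For [N > 0] the two residues add up to a multiple of [N] that is nonzero and below [2 * N]. *)
Lemma addn_modn_opp (u v N : nat) :
  ~~ (N %| u) -> N %| u + v -> u %% N + v %% N = N.
Proof.
case: (posnP N) => [->|N0]; first by rewrite !modn0 dvd0n => _ /eqP.
rewrite /dvdn -modnDm => u0 /dvdnP[t tE].
have := ltn_pmod u N0; have := ltn_pmod v N0.
case: t tE => [|[|t]]; nia.
Qed.

Theorem theorem2p4 (b N d : nat) (hb : 2 <= b) (hN : 1 <= N)
    (hbN : coprime N b) (h2 : in_midy_set b N 2)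
    (hd : d %| mult_order b N) (hd_even : ~~ odd d) :
  in_midy_set b N d /\ midy_multiplier b d N (d %/ 2).
Proof.
case: h2 => _ L2 mp2.
(* Modulo 1 the order is 1, which 2 does not divide. *)
have N1 : 1 < N.
  case: N hN hbN L2 {hd mp2} => [|[|N]] // _ _.
  rewrite /mult_order; case: ex_minnP => n /andP[n0 _] nmin.
  have := nmin 1; rewrite !modn1 eqxx implybT => /(_ isT).
  by case: n n0 {nmin} => [|[|n]].
have d0 : 0 < d := dvdn_gt0 (mult_order_gt0 _ _) hd.
pose e := d %/ 2; have dE : d = e + e by rewrite /e; lia.
pose k := block_length b d N.
have hE : block_length b 2 N = e * k.
  have : mult_order b N = k * d by rewrite /k /block_length divnK.
  by rewrite /block_length dE => ->; rewrite addnn -muln2 mulnA mulnK // mulnC.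
have /(midy_propertyP hb N1 hbN L2) Nh := mp2.
(* [Nh] becomes [N %| 1 + b ^ (e * k)]. *)
rewrite hE !big_ord_recr big_ord0 /= expn0 expn1 add0n in Nh.
split; first split => //; first by lia.
  apply/(midy_propertyP hb N1 hbN hd); rewrite -/k dE big_split_ord /=.
  under [X in _ + X]eq_bigr => i _ do rewrite expnD -expnM (mulnC k).
  by rewrite -big_distrr /= -{1}[X in X + _]mul1n -mulnDl dvdn_mulr.
(* The exponents run from [k] to [d * k]; splitting in half pairs [i.+1 * k] with
   [(e + i).+1 * k]. *)
rewrite /midy_multiplier -/k -/e {1}dE big_add1 /= big_mkord big_split_ord /=.
rewrite -big_split /= (eq_bigr (fun=> N)).
  by rewrite sum_nat_const card_ord.
move=> i _; apply: addn_modn_opp.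
  (* A power of [b] is coprime to [N > 1], hence not divisible by it. *)
  have coNi : coprime N (b ^ (i.+1 * k)) by rewrite coprimeXr.
  by apply/negP => /gcdn_idPl; move/eqP: coNi => ->; lia.
have -> : (e + i).+1 * k = e * k + i.+1 * k by lia.
by rewrite expnD -{1}[X in X + _]mul1n -mulnDl dvdn_mulr.
Qed.
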